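(* Let $L\subseteq\Sigma^*$ be a regular language whose minimal deterministic finite automaton $M$ does not contain ''two cycles in a row''. Then $L$ can be recognized by a 1-way QFA if and only if $M$ contains neither the forbidden construction (I) nor the forbidden construction (II). (The constructions are defined in the context.)
   Context: For a DFA $M$, write $V(q,w)$ for the state reached from state $q$ after reading the word $w$; a state is rejecting if it is not accepting. The minimal automaton of a regular language is the smallest (complete) DFA recognizing it. $(x|y)^*$ is the set of all finite concatenations of copies of $x$ and $y$ (including the empty word). ''Two cycles in a row'': there are pairwise distinct states $q_1,q_2,q_3$ of $M$ and words $x,y$ with $V(q_1,x)=q_2$, $V(q_2,x)=q_2$, $V(q_2,y)=q_3$, $V(q_3,y)=q_3$. Forbidden construction (I): there are states $q_1\ne q_2$ of $M$ and words $x,y$ with $V(q_1,x)=q_2$, $V(q_2,x)=q_2$, $V(q_2,y)=q_1$. Forbidden construction (II): there are words $x,y,z_1,z_2$ and states $q_1,q_2,q_3$ of $M$ with $q_2\neq q_3$; $V(q_1,x)=q_2$; $V(q_2,x)=q_2$; $V(q_1,y)=q_3$; $V(q_3,y)=q_3$; for every $t\in(x|y)^*$ there is $t_1\in(x|y)^*$ with $V(q_2,tt_1)=q_2$; for every $t\in(x|y)^*$ there is $t_1\in(x|y)^*$ with $V(q_3,tt_1)=q_3$; $V(q_2,z_1)$ and $V(q_3,z_2)$ accepting; $V(q_2,z_2)$ and $V(q_3,z_1)$ rejecting. A 1-way quantum finite automaton (QFA) is a tuple $(Q,\Sigma,V,q_0,Q_{acc},Q_{rej})$: $Q$ is a finite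 set of states, $\Sigma$ a finite input alphabet, $q_0\in Q$ the starting state, $Q_{acc},Q_{rej}\subseteq Q$ are disjoint sets of accepting and rejecting states, and $Q_{non}=Q\setminus(Q_{acc}\cup Q_{rej})$. Let $l_2(Q)$ be the complex Hilbert space with orthonormal basis $\{|q\rangle: q\in Q\}$, and $E_{acc},E_{rej},E_{non}$ the spans of $\{|q\rangle\}$ for $q$ in $Q_{acc},Q_{rej},Q_{non}$ respectively. With endmarkers $\kappa,\$\notin\Sigma$ and $\Gamma=\Sigma\cup\{\kappa,\$\}$, $V$ assigns to each $a\in\Gamma$ a unitary map $V_a$ on $l_2(Q)$. On input $w\in\Sigma^*$ the automaton starts in $|q_0\rangle$ and reads the letters of $\kappa w\$$ in order. Reading $a$ in the current (unnormalized) superposition $\psi$ means: compute $V_a\psi$; the automaton accepts (and halts) with probability the squared norm of the projection of $V_a\psi$ onto $E_{acc}$, rejects (and halts) with probability the squared norm of its projection onto $E_{rej}$, and otherwise continues with the unnormalized superposition equal to the projection of $V_a\psi$ onto $E_{non}$. The probability of accepting (rejecting) $w$ is the sum of these acceptance (rejection) probabilities over all letters of $\kappa w\$$. A QFA recognizes $L$ with probability $p>\frac12$ if it accepts every $w\in L$ with probability $\geq p$ and rejects every $w\in\Sigma^*\setminus L$ with probability $\geq p$. $L$ is recognized by a QFA if this holds for some QFA and some $p>\frac12$. *)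

(* Defs.v *)
From mathcomp Require Import all_boot all_order all_algebra.
From mathcomp Require Import spectral classical_sets reals complex.

Set Implicit Arguments.
Unset Strict Implicit.
Unset Printing Implicit Defensive.

Import Order.TTheory GRing.Theory Num.Theory.

Local Open Scope ring_scope.

Record dfa (Sigma : finType) := Dfa {
  dfa_state : finType;
  dfa_start : dfa_state;
  dfa_final : {set dfa_state};
  dfa_trans : dfa_state -> Sigma -> dfa_state
}.

Section Dfa.

Variable Sigma : finType.
Implicit Types (M : dfa Sigma) (L : set (seq Sigma)) (t w x y : seq Sigma).

Definition reach M (q : dfa_state M) w : dfa_state M :=
  foldl (@dfa_trans Sigma M) q w.

Definition dfa_recognizes M L : Prop :=
  forall w, reach (dfa_start M) w \in dfa_final M <-> L w.

Definition minimal_dfa M L : Prop :=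
  dfa_recognizes M L /\
  forall M', dfa_recognizes M' L -> (#|dfa_state M| <= #|dfa_state M'|)%N.

Definition two_cycles_in_a_row M : Prop :=
  exists (q1 q2 q3 : dfa_state M) x y,
    uniq [:: q1; q2; q3] /\
    [/\ reach q1 x = q2, reach q2 x = q2, reach q2 y = q3 & reach q3 y = q3].

Definition construction_I M : Prop :=
  exists (q1 q2 : dfa_state M) x y,
    [/\ q1 <> q2, reach q1 x = q2, reach q2 x = q2 & reach q2 y = q1].

(* The language (x|y)^*. *)
Definition star2 x y : set (seq Sigma) :=
  [set t | exists2 s : seq (seq Sigma),
             {subset s <= [:: x; y]} & t = flatten s].

Definition construction_II M : Prop :=
  exists x y z1 z2 (q1 q2 q3 : dfa_state M),
    [/\ q2 <> q3,
        [/\ reach q1 x = q2, reach q2 x = q2, reach q1 y = q3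
          & reach q3 y = q3],
        forall t, star2 x y t ->
          exists2 t1, star2 x y t1 & reach q2 (t ++ t1) = q2,
        forall t, star2 x y t ->
          exists2 t1, star2 x y t1 & reach q3 (t ++ t1) = q3
      & [/\ reach q2 z1 \in dfa_final M, reach q3 z2 \in dfa_final M,
            reach q2 z2 \notin dfa_final M
          & reach q3 z1 \notin dfa_final M]].

End Dfa.

Inductive tape_symbol (Sigma : Type) : Type :=
  | LeftEnd
  | Letter of Sigma
  | RightEnd.
Arguments LeftEnd {Sigma}.
Arguments RightEnd {Sigma}.

(* l_2(Q) is represented by column vectors of dimension #|Q|, the basis
   vector |q> being the unit vector of index enum_rank q. *)
Record qfa (R : realType) (Sigma : finType) := Qfa {
  qfa_state : finType;
  qfa_trans : tape_symbol Sigma -> 'M[R[i]]_#|qfa_state|;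
  qfa_start : qfa_state;
  qfa_acc : {set qfa_state};
  qfa_rej : {set qfa_state};
  qfa_trans_unitary : forall a, qfa_trans a \is unitarymx;
  qfa_acc_rej_disjoint : [disjoint qfa_acc & qfa_rej]
}.

Definition ket (R : realType) (Q : finType) (q : Q) : 'cV[R[i]]_#|Q| :=
  delta_mx (enum_rank q) 0.

(* Orthogonal projection onto the span of the |q> for q in A. *)
Definition proj_on (R : realType) (Q : finType) (A : {set Q})
    (psi : 'cV[R[i]]_#|Q|) : 'cV[R[i]]_#|Q| :=
  \col_k (if enum_val k \in A then psi k 0 else 0).

Definition sqnorm (R : realType) (n : nat) (psi : 'cV[R[i]]_n) : R :=
  \sum_(k < n) ComplexField.Normc.normc (psi k 0) ^+ 2.

Section Qfa.

Variables (R : realType) (Sigma : finType).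
Implicit Types (A : qfa R Sigma) (L : set (seq Sigma)) (w : seq Sigma).

Definition qfa_non A : {set qfa_state A} := ~: (qfa_acc A :|: qfa_rej A).

(* Total probability of halting in H (H = qfa_acc A or qfa_rej A) while
   reading u from the unnormalized superposition psi. *)
Fixpoint halting_prob A (H : {set qfa_state A})
    (psi : 'cV[R[i]]_#|qfa_state A|) (u : seq (tape_symbol Sigma)) : R :=
  if u is a :: u' then
    let phi := qfa_trans A a *m psi in
    sqnorm (proj_on H phi) + halting_prob H (proj_on (qfa_non A) phi) u'
  else 0.

Definition tape w : seq (tape_symbol Sigma) :=
  LeftEnd :: rcons (map (@Letter Sigma) w) RightEnd.

Definition accept_prob A w : R :=
  halting_prob (qfa_acc A) (ket R (qfa_start A)) (tape w).

Definition reject_prob A w : R :=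
  halting_prob (qfa_rej A) (ket R (qfa_start A)) (tape w).

Definition qfa_recognizes_with A L (p : R) : Prop :=
  forall w, (L w -> p <= accept_prob A w) /\ (~ L w -> p <= reject_prob A w).

Definition qfa_recognizable L : Prop :=
  exists (A : qfa R Sigma) (p : R), 2^-1 < p /\ qfa_recognizes_with A L p.

End Qfa.

(* Main.v *)
Require Import Defs.
From mathcomp Require Import all_boot all_order all_algebra.
From mathcomp Require Import classical_sets reals.
From mathcomp Require Import spectral complex boolp ring lra zify.

(** Necessity.  The operator V'_w of a QFA along a word w (unitary steps
    followed by the projections onto the non-halting space) is a contraction.
    Choose t in (x|y)^* whose V'_t has almost minimal Hilbert-Schmidt norm:
    multiplying V'_t on either side by V'_s, s in (x|y)^*, is then almost
    isometric on the orbit of V'_t, so by pigeonhole V'_(t s^n) and V'_(s^n t)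
    are close to V'_t for some n >= 1.  In construction (I), t x^n and t (xy)^m
    thus lead the QFA to almost the same state with almost the same halting
    probabilities, although they lead M to q2 and q1.  In construction (II) the
    same holds, up to the halting probabilities accumulated so far, for x^n t
    and y^m t, and comparing the continuations z1 and z2 excludes both signs of
    the difference of these accumulated probabilities.

    Sufficiency.  Call a state recurrent if it is reachable from every state
    reachable from it.  Without (I) and two cycles in a row, words act
    injectively on recurrent states, and a fixed point r = r x = q x with
    q <> r is recurrent.  If w leads the start to a recurrent state, there is a
    recurrent "virtual start" s with s w = q0 w and s = s x = q0 x for some x.
    Without (II) the languages of the virtual starts form a chain, so whether w
    belongs to L amounts to comparing the number of virtual starts accepting w
    with a rank depending only on the component of q0 w.  Hence a majority vote
    decides L, between the permutation automata started at the k virtual starts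
    and k + 1 threshold tests of the rank; the latter only have to follow the
    transient part of M, which is reversible once the entrances into its
    components are remembered.  A uniform superposition of reversible automata
    is a QFA. *)

Set Implicit Arguments.
Unset Strict Implicit.
Unset Printing Implicit Defensive.

Import Order.TTheory GRing.Theory Num.Theory.
Import ComplexField.Normc.

Local Open Scope ring_scope.
Local Open Scope complex_scope.
Local Open Scope sesquilinear_scope.

(** * Hilbert-Schmidt norms and almost periodic contractions *)

Section HilbertSchmidt.

Variable R : realType.
Local Notation C := R[i].

Definition msq m n (A : 'M[C]_(m, n)) : R :=
  \sum_i \sum_j normc (A i j) ^+ 2.

Lemma normc_sqr (z : C) : normc z ^+ 2 = complex.Re z ^+ 2 + complex.Im z ^+ 2.
Proof. by case: z => a b /=; rewrite sqr_sqrtr // addr_ge0 ?sqr_ge0. Qed.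

Lemma msq_ge0 m n (A : 'M[C]_(m, n)) : 0 <= msq A.
Proof. by apply: sumr_ge0 => i _; apply: sumr_ge0 => j _; apply: sqr_ge0. Qed.

Lemma msqN m n (A : 'M[C]_(m, n)) : msq (- A) = msq A.
Proof.
apply: eq_bigr => i _; apply: eq_bigr => j _; rewrite !normc_sqr !mxE.
by case: (A i j) => a b /=; rewrite !sqrrN.
Qed.

Lemma msq_parallelogram m n (A B : 'M[C]_(m, n)) :
  msq (A - B) + msq (A + B) = 2 * msq A + 2 * msq B.
Proof.
rewrite /msq !mulr_sumr -!big_split; apply: eq_bigr => i _ /=.
rewrite !mulr_sumr -!big_split; apply: eq_bigr => j _ /=.
rewrite !normc_sqr !mxE; case: (A i j) (B i j) => a b [c d] /=; ring.
Qed.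

(** A triangle inequality without square roots: entrywise, the two sides differ by [s] times
    squares. A small [s] keeps the factor of [A] near 1. *)
Lemma msq_addl m n (A B : 'M[C]_(m, n)) (s : R) : 0 < s ->
  msq (A + B) <= (1 + s) * msq A + (1 + s^-1) * msq B.
Proof.
move=> s0; rewrite /msq !mulr_sumr -!big_split; apply: ler_sum => i _ /=.
rewrite !mulr_sumr -!big_split; apply: ler_sum => j _ /=.
rewrite !normc_sqr !mxE; case: (A i j) (B i j) => a b [c d] /=.
have key (x y : R) : (x + y) ^+ 2 <= (1 + s) * x ^+ 2 + (1 + s^-1) * y ^+ 2.
  rewrite -subr_ge0.
  have -> : (1 + s) * x ^+ 2 + (1 + s^-1) * y ^+ 2 - (x + y) ^+ 2 =
            s * (x - s^-1 * y) ^+ 2 by field; rewrite gt_eqF.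
  by rewrite mulr_ge0 ?sqr_ge0 // ltW.
have := key a c; have := key b d; lra.
Qed.

Lemma msq_trace m n (A : 'M[C]_(m, n)) :
  (msq A)%:C = \tr (A *m A ^t*).
Proof.
rewrite /msq rmorph_sum; apply: eq_bigr => i _; rewrite rmorph_sum !mxE.
apply: eq_bigr => j _; rewrite !mxE normc_sqr.
case: (A i j) => a b; rewrite /= -[((a +i* b)^* )%R]/(a -i* b)%C; simpc.
by rewrite -!expr2 [b * a]mulrC addNr.
Qed.

Lemma msq_unitaryl m n (U : 'M[C]_m) (A : 'M[C]_(m, n)) :
  U \is unitarymx -> msq (U *m A) = msq A.
Proof.
move=> /unitarymxP UU; apply: (@complexI R); rewrite !msq_trace.
rewrite trmx_mul map_mxM mxtrace_mulC mulmxA -(mulmxA _ _ U).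
by rewrite (mulmx1C UU) mulmx1 mxtrace_mulC.
Qed.

Lemma msq_unitaryr m n (U : 'M[C]_n) (A : 'M[C]_(m, n)) :
  U \is unitarymx -> msq (A *m U) = msq A.
Proof.
move=> /unitarymxP UU; apply: (@complexI R); rewrite !msq_trace.
by rewrite trmx_mul map_mxM mulmxA -(mulmxA _ U) UU mulmx1.
Qed.

Lemma sqnorm_msq n (psi : 'cV[C]_n) : sqnorm psi = msq psi.
Proof. by apply: eq_bigr => i _; rewrite big_ord1. Qed.

Lemma ler_msq m n (A B : 'M[C]_(m, n)) :
  (forall i j, A i j = B i j \/ A i j = 0) -> msq A <= msq B.
Proof.
move=> AB; apply: ler_sum => i _; apply: ler_sum => j _.
by case: (AB i j) => ->; rewrite ?normc0 ?expr0n ?sqr_ge0.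
Qed.

Lemma sequence_collision (X : finType) (f : nat -> X) :
  exists i j, (i < j)%N /\ f i = f j.
Proof.
have /injectivePn[i [j ji fij]] : ~~ injectiveb (fun i : 'I_#|X|.+1 => f i).
  by apply/negP => /injectiveP/leq_card; rewrite card_ord ltnn.
case: (ltngtP i j) => [ij|ij|/val_inj eij]; last by rewrite eij eqxx in ji.
  by exists i, j.
by exists j, i.
Qed.

(* Pigeonhole on a grid of small cells. *)
Lemma bounded_sequence_close m n (A : nat -> 'M[C]_(m, n)) (B e : R) :
  (forall k, msq (A k) <= B) -> 0 < e ->
  exists i j, (i < j)%N /\ msq (A i - A j) <= e.
Proof.
move=> AB e0.
have B0 : 0 <= B := le_trans (msq_ge0 _) (AB 0%N).
(* Cell width: [h <= 1] and [h * (2mn + 1) <= e] give [2mn * h ^+ 2 <= e], with two real coordinates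
   per entry. *)
pose h : R := e / ((2 * (m * n)%:R + 1) * (1 + e)).
have mn0 : 0 <= (m * n)%:R :> R by rewrite ler0n.
have d0 : 0 < (2 * (m * n)%:R + 1) * (1 + e) by rewrite mulr_gt0 //; lra.
have h0 : 0 < h by rewrite divr_gt0.
pose N := Num.truncn ((2 * (1 + B)) / h).
pose cell (x : R) : 'I_N.+1 := inord (Num.truncn ((x + (1 + B)) / h)).
have cellP (x y : R) : x ^+ 2 <= B -> y ^+ 2 <= B -> cell x = cell y ->
    (x - y) ^+ 2 <= h ^+ 2.
  move=> xB yB.
  have rg (z : R) : z ^+ 2 <= B -> 0 <= (z + (1 + B)) /\ z <= 1 + B.
    by move=> zB; split; nra.
  have le (z : R) : z ^+ 2 <= B ->
      (Num.truncn ((z + (1 + B)) / h) < N.+1)%N.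
    move=> zB; have [z1 z2] := rg z zB.
    rewrite ltnS; apply: le_truncn; rewrite ler_pM2r ?invr_gt0 //; lra.
  move=> /(congr1 val); rewrite /= !inordK ?le // => exy.
  have [x1 x2] := rg x xB; have [y1 y2] := rg y yB.
  have x3 : 0 <= (x + (1 + B)) / h by rewrite divr_ge0 // ltW.
  have y3 : 0 <= (y + (1 + B)) / h by rewrite divr_ge0 // ltW.
  have /andP[x4 x5] := truncn_itv x3.
  have /andP[y4 y5] := truncn_itv y3.
  rewrite exy in x4 x5.
  move: x4 x5 y4 y5; set t := Num.truncn _.
  rewrite -[t.+1]addn1 natrD !ler_pdivlMr // !ltr_pdivrMr // => *.
  rewrite -real_normK ?num_real //.
  rewrite ler_sqr ?nnegrE ?normr_ge0 ?(ltW h0) // ler_norml; lra.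
pose f k : {ffun 'I_m * 'I_n -> 'I_N.+1 * 'I_N.+1} :=
  [ffun ij => (cell (complex.Re (A k ij.1 ij.2)),
               cell (complex.Im (A k ij.1 ij.2)))].
have [i [j [ij fij]]] := sequence_collision f.
exists i, j; split => //.
have ent k a b : complex.Re (A k a b) ^+ 2 <= B /\ complex.Im (A k a b) ^+ 2 <= B.
  have : normc (A k a b) ^+ 2 <= B.
    apply: le_trans (AB k); rewrite /msq (bigD1 a) //= (bigD1 b) //=.
    rewrite -addrA lerDl addr_ge0 //; first by apply: sumr_ge0 => *; apply: sqr_ge0.
    by apply: sumr_ge0 => *; apply: sumr_ge0 => *; apply: sqr_ge0.
  rewrite normc_sqr; have := sqr_ge0 (complex.Re (A k a b)).
  have := sqr_ge0 (complex.Im (A k a b)); lra.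
have le2 : msq (A i - A j) <= \sum_(a < m) \sum_(b < n) (2 * h ^+ 2).
  apply: ler_sum => a _; apply: ler_sum => b _; rewrite normc_sqr !mxE.
  have /ffunP/(_ (a, b)) := fij; rewrite !ffunE => -[e1 e2] /=.
  have [i1 i2] := ent i a b; have [j1 j2] := ent j a b.
  have := cellP _ _ i1 j1 e1; have := cellP _ _ i2 j2 e2.
  case: (A i a b) (A j a b) => x y [z t] /=; lra.
apply: le_trans le2 _; rewrite !sumr_const !card_ord -mulrnA -mulr_natr mulnC.
have h1 : h <= 1.
  rewrite ler_pdivrMr //; nra.
have h2 : h * (2 * (m * n)%:R + 1) <= e.
  rewrite /h invfM mulrA mulrAC mulfVK ?gt_eqF //; last lra.
  rewrite ler_pdivrMr; nra.
nra.
Qed.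

Section AlmostReturn.

Variables (m n : nat) (T : 'M[C]_(m, n) -> 'M[C]_(m, n)).
Hypothesis T_add : forall A B, T (A + B) = T A + T B.
Hypothesis T_opp : forall A, T (- A) = - T A.
Hypothesis T_contr : forall A, msq (T A) <= msq A.

Lemma iter_contraction k :
  [/\ forall A B, iter k T (A + B) = iter k T A + iter k T B,
      forall A, iter k T (- A) = - iter k T A
    & forall A, msq (iter k T A) <= msq A].
Proof.
elim: k => [//|k [a o c]]; split=> [A B|A|A] /=; first by rewrite a.
  by rewrite o.
exact: le_trans (T_contr _) (c _).
Qed.

(* By the parallelogram law, a contraction which nearly preserves the norms of
   two vectors nearly preserves their distance; so two close points T^i A, T^j A
   of the orbit pull back to A and T^(j-i) A. *)
Lemma contraction_almost_return (A : 'M[C]_(m, n)) (e : R) : 0 < e ->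
  (forall k, msq A <= msq (iter k T A) + e) ->
  exists2 k, (0 < k)%N & msq (iter k T A - A) <= 5 * e.
Proof.
move=> e0 lossA.
have [|i [j [ij close]]] :=
  @bounded_sequence_close m n (fun k => iter k T A) (msq A) e _ e0.
  by move=> k; have [_ _] := iter_contraction k.
exists (j - i)%N; first by rewrite subn_gt0.
have [add opp contr] := iter_contraction i.
set B := iter (j - i) T A.
have TB : iter i T B = iter j T A by rewrite -iterD subnKC // ltnW.
have p1 := msq_parallelogram A B.
have p2 := msq_parallelogram (iter i T A) (iter i T B).
have c1 : msq (iter i T A + iter i T B) <= msq (A + B) by rewrite -add.
have l1 := lossA i; have l2 := lossA j.
have [_ _ /(_ A) c2] := iter_contraction (j - i).
(* Twice the loss [e] for each of [A] and [B], plus the distance [e] of the close images, gives the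
   factor 5. *)
rewrite -TB in l2; rewrite -TB in close.
rewrite -msqN opprB; rewrite -/B in c2 *; lra.
Qed.

End AlmostReturn.

End HilbertSchmidt.

(** * Halting probabilities *)

Definition wpow (T : Type) (w : seq T) n : seq T := flatten (nseq n w).

Lemma wpowSr (T : Type) (w : seq T) n : wpow w n.+1 = wpow w n ++ w.
Proof.
elim: n => [|n IH]; first by rewrite /wpow /= cats0.
by rewrite -[RHS]/((w ++ wpow w n) ++ w) -[LHS]/(w ++ wpow w n.+1) IH catA.
Qed.

Section HaltingProb.

Variables (R : realType) (Sigma : finType) (A : qfa R Sigma).
Local Notation C := R[i].
Local Notation Q := (qfa_state A).
Implicit Types (u v : seq (tape_symbol Sigma)) (w s t z : seq Sigma).
Implicit Types (psi phi : 'cV[C]_#|Q|) (H : {set Q}).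

Definition projmx H : 'M[C]_#|Q| :=
  diag_mx (\row_k (enum_val k \in H)%:R).

Lemma proj_onE H psi : proj_on H psi = projmx H *m psi.
Proof.
apply/matrixP => k j; rewrite mul_diag_mx !mxE ord1.
by case: ifP; rewrite ?mul1r ?mul0r.
Qed.

Lemma msq_projmxl n H (M : 'M[C]_(_, n)) : msq (projmx H *m M) <= msq M.
Proof.
apply: ler_msq => k j; rewrite mul_diag_mx !mxE.
by case: (_ \in H); rewrite ?mul1r ?mul0r; [left|right].
Qed.

Lemma msq_projmxr m H (M : 'M[C]_(m, _)) : msq (M *m projmx H) <= msq M.
Proof.
apply: ler_msq => k j; rewrite mul_mx_diag !mxE.
by case: (_ \in H); rewrite ?mulr1 ?mulr0; [left|right].
Qed.

Definition symop (a : tape_symbol Sigma) : 'M[C]_#|Q| :=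
  projmx (qfa_non A) *m qfa_trans A a.

Fixpoint tapeop u : 'M[C]_#|Q| :=
  if u is a :: u' then tapeop u' *m symop a else 1%:M.

Lemma tapeop_cat u v : tapeop (u ++ v) = tapeop v *m tapeop u.
Proof. by elim: u => [|a u IH] /=; rewrite ?mulmx1 // IH mulmxA. Qed.

Lemma msq_tapeopl n u (M : 'M[C]_(_, n)) : msq (tapeop u *m M) <= msq M.
Proof.
elim: u M => [|a u IH] M /=; first by rewrite mul1mx.
rewrite -mulmxA; apply: le_trans (IH _) _.
rewrite -mulmxA; apply: le_trans (msq_projmxl _ _) _.
by rewrite msq_unitaryl ?qfa_trans_unitary.
Qed.

Lemma msq_tapeopr m u (M : 'M[C]_(m, _)) : msq (M *m tapeop u) <= msq M.
Proof.
elim: u M => [|a u IH] M /=; first by rewrite mulmx1.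
rewrite mulmxA mulmxA msq_unitaryr ?qfa_trans_unitary //.
exact: le_trans (msq_projmxr _ _) (IH _).
Qed.

Lemma halting_prob_cat H psi u v :
  halting_prob H psi (u ++ v) =
  halting_prob H psi u + halting_prob H (tapeop u *m psi) v.
Proof.
elim: u psi => [|a u IH] psi /=; first by rewrite add0r mul1mx.
by rewrite IH addrA !proj_onE !mulmxA.
Qed.

Lemma halting_prob_ge0 H psi u : 0 <= halting_prob H psi u.
Proof.
elim: u psi => [//|a u IH] psi /=.
by rewrite addr_ge0 // sqnorm_msq msq_ge0.
Qed.

(** Conservation of probability: a unitary step keeps the norm, and the measurement splits it
    orthogonally into three parts. *)
Lemma halting_prob_total psi u :
  halting_prob (qfa_acc A) psi u + halting_prob (qfa_rej A) psi u
    + msq (tapeop u *m psi) = msq psi.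
Proof.
elim: u psi => [|a u IH] psi /=; first by rewrite !add0r mul1mx.
rewrite -[RHS](msq_unitaryl psi (@qfa_trans_unitary R Sigma A a)).
move def_phi: (_ *m psi) => phi.
have split3 : msq phi = sqnorm (proj_on (qfa_acc A) phi)
    + sqnorm (proj_on (qfa_rej A) phi) + msq (proj_on (qfa_non A) phi).
  rewrite -!sqnorm_msq /sqnorm -!big_split; apply: eq_bigr => k _ /=.
  rewrite !mxE !inE.
  have := disjoint_setI0 (qfa_acc_rej_disjoint A).
  move=> /setP/(_ (enum_val k)); rewrite !inE.
  by case: (_ \in qfa_acc A) (_ \in qfa_rej A) => [] [] // _;
    rewrite !normc_sqr /= expr0n /= ?(addr0, add0r).
rewrite -mulmxA -mulmxA def_phi -proj_onE split3 -(IH (proj_on (qfa_non A) phi)).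
by ring.
Qed.

Lemma halting_prob_le (b : bool) psi u :
  halting_prob (if b then qfa_acc A else qfa_rej A) psi u
    + msq (tapeop u *m psi) <= msq psi.
Proof.
rewrite -(halting_prob_total psi u).
have := halting_prob_ge0 (qfa_acc A) psi u.
have := halting_prob_ge0 (qfa_rej A) psi u.
by case: b; lra.
Qed.

(** A halting probability is a sum of squared norms of linear images of the state, so [msq_addl]
    applies term by term. *)
Lemma halting_prob_addl H psi phi u (e : R) : 0 < e ->
  halting_prob H (psi + phi) u <=
  (1 + e) * halting_prob H psi u + (1 + e^-1) * halting_prob H phi u.
Proof.
move=> e0; elim: u psi phi => [|a u IH] psi phi /=.
  by rewrite !mulr0 addr0.
rewrite !proj_onE !sqnorm_msq mulmxDr mulmxDr mulmxDr.
have := msq_addl (projmx H *m (qfa_trans A a *m psi))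
  (projmx H *m (qfa_trans A a *m phi)) e0.
have := IH (projmx (qfa_non A) *m (qfa_trans A a *m psi))
  (projmx (qfa_non A) *m (qfa_trans A a *m phi)).
lra.
Qed.

Definition tape_state u : 'cV[C]_#|Q| := tapeop u *m ket R (qfa_start A).

Lemma msq_tape_state u : msq (tape_state u) <= 1.
Proof.
apply: le_trans (msq_tapeopl _ _) _.
rewrite -sqnorm_msq /sqnorm (bigD1 (enum_rank (qfa_start A))) //= big1.
  by rewrite !mxE !eqxx normc1 expr1n addr0.
by move=> k kn; rewrite !mxE (negbTE kn) normc0 expr0n.
Qed.

(** The bound is uniform in the word [u], because the halting probability from [phi - psi] never
    exceeds its squared norm. *)
Lemma halting_prob_continuous (d : R) : 0 < d -> exists2 e : R, 0 < e &
  forall (b : bool) psi phi u, msq psi <= 1 -> msq (phi - psi) <= e ->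
    halting_prob (if b then qfa_acc A else qfa_rej A) phi u <=
    halting_prob (if b then qfa_acc A else qfa_rej A) psi u + d /\
    msq phi <= msq psi + d.
Proof.
move=> d0; have d2 : 0 < d / 2 by rewrite divr_gt0.
have k0 : 0 < 1 + (d / 2)^-1 by rewrite addr_gt0 // invr_gt0.
(* One half of [d] pays for the factor [1 + d / 2] on [psi], the other for the weighted term of
   [phi - psi]. *)
exists ((d / 2) / (1 + (d / 2)^-1)); first by rewrite divr_gt0.
move=> b psi phi u psi1; rewrite ler_pdivlMr // => close.
set H := if b then _ else _.
have e1 := halting_prob_le b psi u; have e2 := halting_prob_le b (phi - psi) u.
have g1 := msq_ge0 (tapeop u *m psi).
have g2 := msq_ge0 (tapeop u *m (phi - psi)).
have := halting_prob_addl H psi (phi - psi) u d2.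
have := msq_addl psi (phi - psi) d2.
have -> : psi + (phi - psi) = phi by rewrite addrC subrK.
rewrite -/H in e1 e2 *.
have a1 : (1 + (d / 2)^-1) * halting_prob H (phi - psi) u <=
  (1 + (d / 2)^-1) * msq (phi - psi) by rewrite ler_pM2l //; lra.
have a2 : d / 2 * halting_prob H psi u <= d / 2 by rewrite -[leRHS]mulr1 ler_pM2l //; lra.
have a3 : d / 2 * msq psi <= d / 2 by rewrite -[leRHS]mulr1 ler_pM2l.
move=> h1 h2; split; first lra.
lra.
Qed.

Definition letters w : seq (tape_symbol Sigma) := map (@Letter Sigma) w.

Definition wop w := tapeop (letters w).

Lemma wop_cat w s : wop (w ++ s) = wop s *m wop w.
Proof. by rewrite /wop /letters map_cat tapeop_cat. Qed.

(** Words are allowed on both sides of [t], so that almost returns follow for appended and for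
    prepended powers alike. *)
Definition near_minimal (P : set (seq Sigma)) (e : R) t : Prop :=
  forall s1 s2, P s1 -> P s2 -> msq (wop t) <= msq (wop (s1 ++ t ++ s2)) + e.

(** * Almost returns along a submonoid of words *)

Section Submonoid.

Variable P : set (seq Sigma).
Hypothesis P_nil : P [::].
Hypothesis P_cat : forall s t, P s -> P t -> P (s ++ t).

Lemma submonoid_wpow s n : P s -> P (wpow s n).
Proof. by move=> Ps; elim: n => [|n IH] //=; apply: P_cat. Qed.

(** Choose [t] within [e] of the infimum of the norms over [P]; [s1 ++ t ++ s2] is still in [P]. *)
Lemma near_minimal_exists (e : R) : 0 < e -> exists2 t, P t & near_minimal P e t.
Proof.
move=> e0; pose E : set R := [set msq (wop t) | t in P]%classic.
have infE : has_inf E.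
  by split; [exists (msq (wop [::])), [::] | exists 0 => _ [t _ <-]; apply: msq_ge0].
have [_ [t Pt <-] lt_t] := inf_adherent e0 infE.
exists t => // s1 s2 P1 P2; apply: le_trans (ltW lt_t) _; rewrite lerD2r.
by apply: (ge_inf infE.2); exists (s1 ++ t ++ s2) => //; apply/P_cat/P_cat.
Qed.

Lemma near_minimal_cat e t s :
  P s -> near_minimal P e t -> near_minimal P e (t ++ s).
Proof.
move=> Ps mt s1 s2 P1 P2; rewrite -catA.
apply: le_trans (mt s1 (s ++ s2) P1 _); last exact: P_cat.
by rewrite wop_cat; apply: msq_tapeopl.
Qed.

(** [contraction_almost_return] for left multiplication by [wop s], whose orbit of [wop t] runs
    through the words [t s^k]. *)
Lemma near_minimal_returnr e t s : 0 < e -> near_minimal P e t -> P s ->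
  exists2 n, (0 < n)%N & msq (wop (t ++ wpow s n) - wop t) <= 5 * e.
Proof.
move=> e0 mt Ps; pose T (M : 'M[C]_#|Q|) := wop s *m M.
have iterT k : iter k T (wop t) = wop (t ++ wpow s k).
  elim: k => [|k IH]; first by rewrite cats0.
  by rewrite iterS IH /T -wop_cat -catA wpowSr.
have [| | |k|n n0] := @contraction_almost_return R _ _ T _ _ _ (wop t) e e0.
- by move=> M N; rewrite /T mulmxDr.
- by move=> M; rewrite /T mulmxN.
- by move=> M; apply: msq_tapeopl.
- by rewrite iterT; apply: (mt [::] (wpow s k)) => //; apply: submonoid_wpow.
by rewrite iterT; exists n.
Qed.

Lemma near_minimal_returnl e t s : 0 < e -> near_minimal P e t -> P s ->
  exists2 n, (0 < n)%N & msq (wop (wpow s n ++ t) - wop t) <= 5 * e.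
Proof.
move=> e0 mt Ps; pose T (M : 'M[C]_#|Q|) := M *m wop s.
have iterT k : iter k T (wop t) = wop (wpow s k ++ t).
  elim: k => [//|k IH].
  by rewrite iterS IH /T -wop_cat catA.
have [| | |k|n n0] := @contraction_almost_return R _ _ T _ _ _ (wop t) e e0.
- by move=> M N; rewrite /T mulmxDl.
- by move=> M; rewrite /T mulNmx.
- by move=> M; apply: msq_tapeopr.
- rewrite iterT -[wpow s k ++ t]cats0 -catA.
  by apply: (mt (wpow s k) [::]) => //; apply: submonoid_wpow.
by rewrite iterT; exists n.
Qed.

End Submonoid.

Definition rest z := rcons (letters z) RightEnd.
Definition prefix_state w := tape_state (LeftEnd :: letters w).
Definition prefix_acc w : R :=
  halting_prob (qfa_acc A) (ket R (qfa_start A)) (LeftEnd :: letters w).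

Lemma accept_prob_cat w z : accept_prob A (w ++ z) =
  prefix_acc w + halting_prob (qfa_acc A) (prefix_state w) (rest z).
Proof.
by rewrite -halting_prob_cat /accept_prob /tape /rest map_cat rcons_cat.
Qed.

Lemma prefix_acc_cat w s : prefix_acc (w ++ s) =
  prefix_acc w + halting_prob (qfa_acc A) (prefix_state w) (letters s).
Proof. by rewrite -halting_prob_cat /prefix_acc /letters map_cat. Qed.

Lemma prefix_state_cat w s : prefix_state (w ++ s) = wop s *m prefix_state w.
Proof.
by rewrite /prefix_state /letters map_cat /tape_state -cat_cons tapeop_cat mulmxA.
Qed.

Lemma prefix_state_close w s t :
  msq (prefix_state (w ++ s) - prefix_state (w ++ t)) <= msq (wop s - wop t).
Proof.
rewrite !prefix_state_cat -mulmxBl /prefix_state /tape_state mulmxA.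
apply: le_trans (msq_tapeopr (LeftEnd :: letters w) (wop s - wop t)).
(* Applying [M] to a basis vector selects one column, whose norm is at most that of [M]. *)
set M := (wop s - wop t) *m _; rewrite /ket -colE /msq; apply: ler_sum => i _.
rewrite big_ord1 mxE (bigD1 (enum_rank (qfa_start A))) //= lerDl.
by apply: sumr_ge0 => j _; apply: sqr_ge0.
Qed.

Lemma accept_reject_le1 w : accept_prob A w + reject_prob A w <= 1.
Proof.
have := halting_prob_total (ket R (qfa_start A)) (tape w).
have := msq_tape_state [::]; rewrite /tape_state mul1mx.
have := msq_ge0 (tapeop (tape w) *m ket R (qfa_start A)).
rewrite /accept_prob /reject_prob; lra.
Qed.

Section Insertion.

Variable P : set (seq Sigma).
Hypothesis P_nil : P [::].
Hypothesis P_cat : forall s t, P s -> P t -> P (s ++ t).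

(** Inserting [s^n] after [t] hardly changes the state; the probability of halting within [s^n] is
    at most the norm lost there, hence small as well. Each effect costs [d / 2]. *)
Lemma accept_prob_insert (d : R) : 0 < d -> exists2 t, P t &
  forall s, P s -> exists2 n, (0 < n)%N & forall w z,
    `|accept_prob A (w ++ t ++ wpow s n ++ z) - accept_prob A (w ++ t ++ z)| <= d.
Proof.
move=> d0; have d2 : 0 < d / 2 by rewrite divr_gt0.
have [e e0 He] := halting_prob_continuous d2.
have e5 : 0 < e / 5 by rewrite divr_gt0.
have [t Pt mt] := near_minimal_exists P_nil P_cat e5.
exists t => // s Ps; have [n n0 close] := near_minimal_returnr P_nil P_cat e5 mt Ps.
exists n => // w z; rewrite [5 * _]mulrC mulfVK ?pnatr_eq0 // in close.
have {}close := le_trans (prefix_state_close w _ _) close.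
have -> : w ++ t ++ wpow s n ++ z = ((w ++ t) ++ wpow s n) ++ z.
  by rewrite !catA.
rewrite (catA w t z) !accept_prob_cat prefix_acc_cat.
rewrite catA in close; set phi := prefix_state _ in close *.
set psi := prefix_state _ in close *.
have phi1 : msq phi <= 1 := msq_tape_state _.
have psi1 : msq psi <= 1 := msq_tape_state _.
have [h1 h2] := He true _ _ (rest z) psi1 close.
rewrite -msqN opprB in close.
have [h3 h4] := He true _ _ (rest z) phi1 close.
have := halting_prob_le true psi (letters (wpow s n)).
rewrite -/(wop _) -prefix_state_cat -/phi /=.
have := halting_prob_ge0 (qfa_acc A) psi (letters (wpow s n)).
rewrite ler_norml; lra.
Qed.

(** With [s^n] placed before [t], much may be accepted along the way; this amount is [c], which does
    not depend on [z]. The word [r] allows [t] to be prolonged after it has been chosen. *)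
Lemma accept_prob_shift (d : R) : 0 < d -> exists2 t, P t &
  forall r, P r -> forall s, P s -> exists2 n, (0 < n)%N & forall w, exists c, forall z,
    `|accept_prob A (w ++ wpow s n ++ t ++ r ++ z) - c -
      halting_prob (qfa_acc A) (prefix_state (w ++ t ++ r)) (rest z)| <= d.
Proof.
move=> d0; have [e e0 He] := halting_prob_continuous d0.
have e5 : 0 < e / 5 by rewrite divr_gt0.
have [t Pt mt0] := near_minimal_exists P_nil P_cat e5.
exists t => // r Pr s Ps; have mt := near_minimal_cat P_cat Pr mt0.
have [n n0 close] := near_minimal_returnl P_nil P_cat e5 mt Ps.
exists n => // w; rewrite [5 * _]mulrC mulfVK ?pnatr_eq0 // in close.
have {}close := le_trans (prefix_state_close w _ _) close.
exists (prefix_acc (w ++ wpow s n ++ t ++ r)) => z.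
have -> : w ++ wpow s n ++ t ++ r ++ z = (w ++ wpow s n ++ t ++ r) ++ z.
  by rewrite !catA.
rewrite accept_prob_cat; set phi := prefix_state _ in close *.
set psi := prefix_state _ in close *.
have phi1 : msq phi <= 1 := msq_tape_state _.
have psi1 : msq psi <= 1 := msq_tape_state _.
have [h1 _] := He true _ _ (rest z) psi1 close.
rewrite -msqN opprB in close.
have [h3 _] := He true _ _ (rest z) phi1 close.
rewrite ler_norml; lra.
Qed.

End Insertion.

End HaltingProb.

(** * Necessity of the absence of the forbidden constructions *)

Section DfaWords.

Variables (Sigma : finType) (M : dfa Sigma).
Local Notation Q := (dfa_state M).
Implicit Types (q r s : Q) (u v w x y z t : seq Sigma).

Lemma reach_cat q u v : reach q (u ++ v) = reach (reach q u) v.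
Proof. exact: foldl_cat. Qed.

Lemma wpowD (T : Type) (w : seq T) i j : wpow w (i + j) = wpow w i ++ wpow w j.
Proof. by rewrite /wpow nseqD flatten_cat. Qed.

Lemma wpowM (T : Type) (w : seq T) i j : wpow w (i * j) = wpow (wpow w i) j.
Proof. by elim: j => [|j IH]; rewrite ?muln0 // mulnS wpowD IH. Qed.

Lemma wpow_pos (T : Type) (w : seq T) n : (0 < n)%N -> wpow w n = w ++ wpow w n.-1.
Proof. by case: n. Qed.

Lemma reach_wpow_fix q w n : reach q w = q -> reach q (wpow w n) = q.
Proof. by move=> qw; elim: n => [//|n IH]; rewrite wpowSr reach_cat IH. Qed.

(** The orbit of [q] under [w] is eventually periodic; the exponent is a positive multiple of a
    period, beyond the preperiod. *)
Lemma reach_wpow_idem q w : exists2 n, (0 < n)%N &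
  reach (reach q (wpow w n)) (wpow w n) = reach q (wpow w n).
Proof.
have [i [j [ij eij]]] := sequence_collision (fun k => reach q (wpow w k)).
pose p := (j - i)%N; have p0 : (0 < p)%N by rewrite subn_gt0.
have per k : (i <= k)%N -> reach q (wpow w (k + p)) = reach q (wpow w k).
  move=> ik; rewrite -(subnKC ik) addnAC /p (subnKC (ltnW ij)) !wpowD !reach_cat.
  by rewrite eij.
have perM k m : (i <= k)%N -> reach q (wpow w (k + m * p)) = reach q (wpow w k).
  move=> ik; elim: m => [|m IH]; first by rewrite addn0.
  by rewrite mulSnr addnA per ?IH // (leq_trans ik) // leq_addr.
have ip : (i <= i.+1 * p)%N by rewrite (leq_trans (leqnSn i)) // leq_pmulr.
exists (i.+1 * p)%N; first by rewrite muln_gt0.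
by rewrite -reach_cat -wpowD perM.
Qed.

End DfaWords.

(** * Reachability and distinguishability in minimal automata *)

Section Redirect.

Variables (Sigma : finType) (M : dfa Sigma) (L : set (seq Sigma)).
Hypothesis M_min : minimal_dfa M L.
Local Notation Q := (dfa_state M).

(** Sending every transition through [f] yields an equivalent automaton whose states are those in
    [P]; by minimality none is missing. The invariant [good] limits where [f] has to preserve
    languages. *)
Lemma minimal_redirect (good : Q -> Prop) (P : pred Q) (f : Q -> {q | P q}) :
  good (dfa_start M) -> (forall q a, good q -> good (dfa_trans q a)) ->
  (forall q, good q -> good (val (f q)) /\
     forall w, (reach (val (f q)) w \in dfa_final M) =
               (reach q w \in dfa_final M)) ->
  forall q, P q.
Proof.
move=> good0 good_trans good_f q.
pose M' := @Dfa Sigma {q | P q} (f (dfa_start M))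
  [set p | val p \in dfa_final M] (fun p a => f (dfa_trans (val p) a)).
have equiv w (p : {q | P q}) (r : Q) : good r -> good (val p) ->
    (forall w, (reach (val p) w \in dfa_final M) = (reach r w \in dfa_final M)) ->
    (@reach _ M' p w \in dfa_final M') = (reach r w \in dfa_final M).
  elim: w p r => [|a w IH] p r gr gp pr; first by rewrite inE; exact: (pr [::]).
  have [g1 h1] := good_f _ (good_trans _ a gp).
  rewrite /=; apply: IH => // [|w']; first exact: good_trans.
  by rewrite h1; exact: (pr (a :: w')).
have [Mrec M_le] := M_min.
have leM : (#|Q| <= #|dfa_state M'|)%N.
  apply: M_le => w; rewrite -Mrec; have [g1 h1] := good_f _ good0.
  by rewrite [in X in X <-> _](equiv w _ (dfa_start M)).
apply: contraTT leM => nPq; rewrite -ltnNge card_sig.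
rewrite -[X in (_ < X)%N](cardC P) -[X in (X < _)%N]addn0 ltn_add2l.
by apply/card_gt0P; exists q.
Qed.

Lemma minimal_reachable q : exists w, reach (dfa_start M) w = q.
Proof.
pose reachable q := exists w, reach (dfa_start M) w = q.
pose P q := `[< reachable q >].
have P0 : P (dfa_start M) by apply/asboolP; exists [::].
apply/asboolP; apply: (@minimal_redirect reachable P (insubd (Sub _ P0))).
- by exists [::].
- by move=> r a [w <-]; exists (rcons w a); rewrite /reach foldl_rcons.
- move=> r r_reach; have Pr : P r by apply/asboolP.
  by rewrite val_insubd Pr.
Qed.

(** Otherwise [q1] could be redirected to [q2] and dropped. *)
Lemma minimal_distinguishable q1 q2 : q1 <> q2 ->
  exists w, (reach q1 w \in dfa_final M) <> (reach q2 w \in dfa_final M).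
Proof.
move=> q12; apply: contrapT => /forallNP same.
pose P : pred Q := predC1 q1.
have P2 : P q2 by apply/eqP => /esym.
suff /(_ q1) : forall q, P q by rewrite /P /= eqxx.
apply: (@minimal_redirect (fun=> True) P (insubd (Sub q2 P2 : {q | P q}))) => //.
move=> q _; split => // w; rewrite val_insubd /= /P /=.
by case: eqVneq => [->|//]; apply/esym; apply: contrapT; apply: same.
Qed.

End Redirect.

Section Necessity.

Variables (R : realType) (Sigma : finType) (L : set (seq Sigma)) (M : dfa Sigma).
Hypothesis M_min : minimal_dfa M L.
Variables (A : qfa R Sigma) (p : R).
Hypothesis p_gt : 2^-1 < p.
Hypothesis A_rec : qfa_recognizes_with A L p.
Local Notation F := (dfa_final M).

(** The tolerance for both constructions: two such errors stay below the gap [2p - 1] between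
    accepting and rejecting words. *)
Lemma margin_gt0 : 0 < (2 * p - 1) / 4.
Proof.
rewrite divr_gt0 // subr_gt0.
by have := p_gt; rewrite -[2^-1]mul1r ltr_pdivrMr // mulrC.
Qed.

Lemma accept_ge w : reach (dfa_start M) w \in F -> p <= accept_prob A w.
Proof. by move=> /(M_min.1 w) Lw; have [] := A_rec w; auto. Qed.

Lemma accept_le w : reach (dfa_start M) w \notin F -> accept_prob A w <= 1 - p.
Proof.
move=> nFw; have [_ /(_ _)] := A_rec w.
have := accept_reject_le1 A w => le1 h; have {}h : p <= reject_prob A w.
  by apply: h => /(M_min.1 w); rewrite (negbTE nFw).
lra.
Qed.

Lemma star2_nil (x y : seq Sigma) : star2 x y [::].
Proof. by exists [::]. Qed.

Lemma star2_cat (x y s t : seq Sigma) :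
  star2 x y s -> star2 x y t -> star2 x y (s ++ t).
Proof.
move=> [s' Hs ->] [t' Ht ->]; exists (s' ++ t'); last by rewrite flatten_cat.
by move=> w; rewrite mem_cat => /orP[/Hs|/Ht].
Qed.

Lemma star2_l (x y : seq Sigma) : star2 x y x.
Proof. by exists [:: x]; rewrite ?cats0 /= ?cats0 // => w; rewrite !inE => ->. Qed.

Lemma star2_r (x y : seq Sigma) : star2 x y y.
Proof.
by exists [:: y]; rewrite /= ?cats0 // => w; rewrite !inE => ->; rewrite orbT.
Qed.

Lemma star2_stable (P : dfa_state M -> Prop) (x y : seq Sigma) :
  (forall q, P q -> P (reach q x)) -> (forall q, P q -> P (reach q y)) ->
  forall t q, star2 x y t -> P q -> P (reach q t).
Proof.
move=> Px Py t q [s sxy ->]; elim: s q sxy => [//|w s IH] q sxy Pq /=.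
rewrite reach_cat; apply: IH => [v vs|]; first by apply: sxy; rewrite inE vs orbT.
by have := sxy w; rewrite !inE eqxx => /(_ isT) /orP[] /eqP ->; auto.
Qed.

Lemma recognizable_no_construction_I : ~ construction_I M.
Proof.
move=> [q1 [q2 [x [y [q12 q1x q2x q2y]]]]].
have d0 := margin_gt0.
(* The generators are [x] and [xy], not [x] and [y]: on both [q1] and [q2], [x] leads to [q2] and
   [xy] to [q1], so it does not matter where [t] ends. *)
have [t Pt H] :=
  @accept_prob_insert R Sigma A (star2 x (x ++ y)) (star2_nil _ _)
    (@star2_cat _ _) _ d0.
have [n1 n1_gt H1] := H _ (star2_l _ _).
have [n2 n2_gt H2] := H _ (star2_r _ _).
have [z qz] := minimal_distinguishable M_min q12.
have [w wq1] := minimal_reachable M_min q1.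
have qt : reach q1 t = q1 \/ reach q1 t = q2.
  apply: (@star2_stable (fun q => q = q1 \/ q = q2) x (x ++ y)) => //.
  - by move=> q [] ->; right.
  - by move=> q [] ->; left; rewrite reach_cat ?q1x ?q2x.
  - by left.
have r1 : reach (dfa_start M) (w ++ t ++ wpow x n1 ++ z) = reach q2 z.
  rewrite !reach_cat wq1 (wpow_pos _ n1_gt) !reach_cat.
  by case: qt => ->; rewrite ?q1x ?q2x reach_wpow_fix.
have r2 : reach (dfa_start M) (w ++ t ++ wpow (x ++ y) n2 ++ z) = reach q1 z.
  rewrite !reach_cat wq1 (wpow_pos _ n2_gt) !reach_cat.
  by case: qt => ->; rewrite ?q1x ?q2x q2y reach_wpow_fix // reach_cat q1x.
have := H1 w z; have := H2 w z; rewrite !ler_norml.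
have [zF1|zF1] := boolP (reach q1 z \in F).
  have zF2 : reach q2 z \notin F by apply/negP => e; apply: qz; rewrite e zF1.
  rewrite -r1 in zF2; rewrite -r2 in zF1.
  have := accept_ge zF1; have := accept_le zF2; lra.
have zF2 : reach q2 z \in F.
  by apply: contraPT qz => e; rewrite (negbTE e) (negbTE zF1).
rewrite -r1 in zF2; rewrite -r2 in zF1.
have := accept_ge zF2; have := accept_le zF1; lra.
Qed.

(** If an idempotent power of [t] moved [q], then [q], its image and the way back would form
    construction (I). *)
Lemma return_wpow (q : dfa_state M) (P : set (seq Sigma)) t :
  (forall t, P t -> exists2 t1, P t1 & reach q (t ++ t1) = q) ->
  (forall n, P (wpow t n)) ->
  exists2 n, (0 < n)%N & reach q (wpow t n) = q.
Proof.
move=> ret Pn; have [n n0 idem] := reach_wpow_idem q t; exists n => //.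
apply: contrapT => ne; apply: recognizable_no_construction_I.
have [y _ qy] := ret _ (Pn n); exists q, (reach q (wpow t n)), (wpow t n), y.
by split=> //; [move=> e; apply: ne|rewrite -reach_cat].
Qed.

Lemma recognizable_no_construction_II : ~ construction_II M.
Proof.
move=> [x [y [z1 [z2 [q1 [q2 [q3 [q23 [q1x q2x q1y q3y] ret2 ret3]]]]]]]].
move=> [F21 F32 F22 F31].
have d0 := margin_gt0.
have [t Pt H] :=
  @accept_prob_shift R Sigma A (star2 x y) (star2_nil _ _) (@star2_cat _ _) _ d0.
have Pn n : star2 x y (wpow t n).
  exact: (submonoid_wpow (star2_nil x y) (@star2_cat x y)).
have [n2 n2_gt q2t] := return_wpow ret2 Pn.
have [n3 n3_gt q3t] := return_wpow ret3 Pn.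
(* A common exponent: [t^N] fixes both [q2] and [q3]. Below, [r] is [t^(N-1)], so that
   [t r = t^N]. *)
pose N := (n2 * n3)%N; have N_gt : (0 < N)%N by rewrite muln_gt0 n2_gt.
have q2N : reach q2 (wpow t N) = q2 by rewrite wpowM reach_wpow_fix.
have q3N : reach q3 (wpow t N) = q3 by rewrite /N mulnC wpowM reach_wpow_fix.
have [w wq1] := minimal_reachable M_min q1.
have [nx nx_gt /(_ w)[cx Hx]] := H _ (Pn N.-1) _ (star2_l x y).
have [ny ny_gt /(_ w)[cy Hy]] := H _ (Pn N.-1) _ (star2_r x y).
have tN z : t ++ wpow t N.-1 ++ z = wpow t N ++ z.
  by rewrite catA -[in RHS](prednK N_gt).
have rx z : reach (dfa_start M) (w ++ wpow x nx ++ t ++ wpow t N.-1 ++ z) = reach q2 z.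
  rewrite tN !reach_cat wq1 (wpow_pos _ nx_gt) !reach_cat q1x.
  by rewrite (reach_wpow_fix _ q2x) q2N.
have ry z : reach (dfa_start M) (w ++ wpow y ny ++ t ++ wpow t N.-1 ++ z) = reach q3 z.
  rewrite tN !reach_cat wq1 (wpow_pos _ ny_gt) !reach_cat q1y.
  by rewrite (reach_wpow_fix _ q3y) q3N.
rewrite -rx in F21; rewrite -rx in F22; rewrite -ry in F31; rewrite -ry in F32.
have := accept_ge F21; have := accept_le F22.
have := accept_ge F32; have := accept_le F31.
(* Subtracting the bounds for [z1] and [z2] cancels [cx] and [cy]. The same state after [w t^N]
   would then have to favour [z1] because of [x] and [z2] because of [y]. *)
have := Hx z1; have := Hx z2; have := Hy z1; have := Hy z2.
rewrite !ler_norml; lra.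
Qed.

End Necessity.

(** * Recurrent and transient states *)

Section Recurrence.

Variables (Sigma : finType) (M : dfa Sigma).
Local Notation Q := (dfa_state M).
Local Notation F := (dfa_final M).
Local Notation q0 := (dfa_start M).
Implicit Types (q r s : Q) (u v w x y z t : seq Sigma).

Hypothesis noI : ~ construction_I M.
Hypothesis noII : ~ construction_II M.
Hypothesis no2 : ~ two_cycles_in_a_row M.

Definition conn : rel Q := connect [rel q r | [exists a, dfa_trans q a == r]].

Lemma connP q r : reflect (exists w, reach q w = r) (conn q r).
Proof.
apply: (iffP idP) => [/connectP[p]|[w <-]].
  elim: p q => [|q' p IH] q /= => [_ ->|/andP[/existsP[a /eqP qa] /IH h] /h[w wr]].
    by exists [::].
  by exists (a :: w); rewrite /= qa.
elim: w q => [|a w IH] q; first exact: connect0.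
apply: connect_trans (IH _); apply: connect1.
by apply/existsP; exists a.
Qed.

Lemma conn_reach q w : conn q (reach q w).
Proof. by apply/connP; exists w. Qed.

Definition recurrent q : bool := [forall r, conn q r ==> conn r q].

Lemma recurrentP q : reflect (forall w, conn (reach q w) q) (recurrent q).
Proof.
apply: (iffP forallP) => [h w|h r]; first exact: implyP (h _) (conn_reach q w).
by apply/implyP => /connP[w <-].
Qed.

Lemma recurrent_reach q w : recurrent q -> recurrent (reach q w).
Proof.
move=> /recurrentP rq; apply/recurrentP => v; rewrite -reach_cat.
exact: connect_trans (rq _) (conn_reach q w).
Qed.

(** If [u] leads from [q w] back to [q], then [w u] sends both [q] and [r] to [q], and [q] reaches
    [r]: construction (I) unless they coincide. *)
Lemma component_inj q r w :
  conn (reach q w) q -> conn (reach q w) r -> reach q w = reach r w -> q = r.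
Proof.
move=> /connP[u qu] wr qwr; apply: contrapT => qr; apply: noI.
have /connP[y qy] : conn q r := connect_trans (conn_reach q w) wr.
exists r, q, (w ++ u), y; rewrite !reach_cat -qwr qu; split=> //.
by move=> e; apply: qr.
Qed.

Lemma recurrent_inj q r w :
  recurrent q -> recurrent r -> reach q w = reach r w -> q = r.
Proof.
move=> /recurrentP rq /recurrentP rr qwr; apply: (component_inj (rq w) _ qwr).
by rewrite qwr; apply: rr.
Qed.

Lemma recurrent_wpow q w :
  recurrent q -> exists2 n, (0 < n)%N & reach q (wpow w n) = q.
Proof.
move=> rq; have [n n0 idem] := reach_wpow_idem q w; exists n => //.
exact: recurrent_inj (recurrent_reach _ rq) rq idem.
Qed.

(** An idempotent power of [w] leads [r] to [r], which gives the return, to [q], which gives (I), or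
    to a third state, which gives two cycles in a row. *)
Lemma fixpoint_recurrent q r x :
  q <> r -> reach q x = r -> reach r x = r -> recurrent r.
Proof.
move=> qr qx rx; apply/recurrentP => w.
have [n n0 idem] := reach_wpow_idem r w.
have [e|ne] := eqVneq (reach r (wpow w n)) r.
  apply/connP; exists (wpow w n.-1); rewrite -reach_cat -{2}e.
  by rewrite (wpow_pos w n0).
have [e|ne'] := eqVneq (reach r (wpow w n)) q.
  by case: noI; exists q, r, x, (wpow w n).
case: no2; exists q, r, (reach r (wpow w n)), x, (wpow w n).
split=> //; have /eqP qr' := qr.
by rewrite /= !inE negb_or qr' (eq_sym q) ne' (eq_sym r) ne.
Qed.

Definition lang_le s s' : bool :=
  `[< forall w, reach s w \in F -> reach s' w \in F >].

(* The recurrent states in which a word leading there from the start could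
   have been run all along. *)
Definition virtual_start : {set Q} :=
  [set s | recurrent s && `[< exists2 x, reach q0 x = s & reach s x = s >]].

Lemma virtual_startP s : s \in virtual_start ->
  recurrent s /\ exists2 x, reach q0 x = s & reach s x = s.
Proof. by rewrite inE => /andP[rs /asboolP]. Qed.

(** Take [s = q0 w^n] for an idempotent power: [s w] and [q0 w] agree after [w^(n-1)], which can be
    cancelled on recurrent states. *)
Lemma virtual_start_of w : recurrent (reach q0 w) ->
  exists2 s, s \in virtual_start & reach s w = reach q0 w.
Proof.
move=> rw; have [n n0 idem] := reach_wpow_idem q0 w.
have rn : recurrent (reach q0 (wpow w n)).
  by rewrite (wpow_pos _ n0) reach_cat recurrent_reach.
exists (reach q0 (wpow w n)).
  by rewrite inE rn; apply/asboolP; exists (wpow w n).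
apply: (@recurrent_inj _ _ (wpow w n.-1)) => //; first exact: recurrent_reach.
by rewrite -!reach_cat -wpow_pos // reach_cat idem.
Qed.

(** Two incomparable virtual starts form construction (II) with [q0]: [z1] and [z2] witness the
    failed inclusions, and powers of words provide the returns. *)
Lemma virtual_start_chain s s' : s \in virtual_start -> s' \in virtual_start ->
  lang_le s s' || lang_le s' s.
Proof.
move=> /virtual_startP[rs [x q0x sx]] /virtual_startP[rs' [y q0y sy]].
rewrite -[_ || _]negbK negb_or; apply/negP => /andP[/asboolPn n1 /asboolPn n2].
have [z1 /not_implyP[a1 b1]] : exists z, ~ (reach s z \in F -> reach s' z \in F).
  by apply: contrapT => /forallNP h; apply: n1 => w; apply: contrapT; apply: h.
have [z2 /not_implyP[a2 b2]] : exists z, ~ (reach s' z \in F -> reach s z \in F).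
  by apply: contrapT => /forallNP h; apply: n2 => w; apply: contrapT; apply: h.
have ret q t : recurrent q -> star2 x y t ->
    exists2 t1, star2 x y t1 & reach q (t ++ t1) = q.
  move=> rq xyt; have [n n0 e] := recurrent_wpow t rq.
  exists (wpow t n.-1); last by rewrite -wpow_pos.
  exact: (submonoid_wpow (star2_nil x y) (@star2_cat _ x y)).
apply: noII; exists x, y, z1, z2, q0, s, s'; split => //.
- by move=> e; apply: b1; rewrite -e.
- by move=> t; apply: ret.
- by move=> t; apply: ret.
by split=> //; apply/negP.
Qed.

Lemma lang_le_trans : transitive lang_le.
Proof.
move=> r q s /asboolP h1 /asboolP h2; apply/asboolP => w hw.
by apply: h2; apply: h1.
Qed.

Lemma lang_le_reach s s' w : lang_le s s' -> lang_le (reach s w) (reach s' w).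
Proof.
by move=> /asboolP h; apply/asboolP => v; rewrite -!reach_cat; apply: h.
Qed.

(** If instead [s'] lies below [s], applying [v] puts [s' v] below [s v = s']; by iteration
    [s = s' v^(n-1)] is below [s'] too. *)
Lemma virtual_start_component s s' : s \in virtual_start -> s' \in virtual_start ->
  conn s s' -> lang_le s s'.
Proof.
move=> Ss Ss' /connP[v sv].
have [//|le] := orP (virtual_start_chain Ss Ss').
have [rs _] := virtual_startP Ss; have [n n0 svn] := recurrent_wpow v rs.
have s'v : lang_le (reach s' v) s' by rewrite -{2}sv; apply: lang_le_reach.
have le_n k : lang_le (reach s' (wpow v k)) s'.
  elim: k => [|k IH]; first by apply/asboolP.
  by rewrite wpowSr reach_cat; apply: lang_le_trans s'v; apply: lang_le_reach.
by have := le_n n.-1; rewrite -{1}sv -reach_cat -wpow_pos // svn.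
Qed.

(** On transient states the values 0 and [#|virtual_start|.+1] force the outcome of a comparison
    with any number of accepting virtual starts. *)
Definition rank q : nat :=
  if recurrent q then
    #|[set s' in virtual_start |
        [exists s, [&& s \in virtual_start, conn q s & lang_le s s']]]|
  else if q \in F then 0 else #|virtual_start|.+1.

Lemma rank_le q : (rank q <= #|virtual_start|.+1)%N.
Proof.
rewrite /rank; case: ifP => _; last by case: ifP.
by apply/leqW/subset_leq_card/fintype.subsetP => s; rewrite inE => /andP[].
Qed.

Lemma rank_reach q w : recurrent q -> rank (reach q w) = rank q.
Proof.
move=> rq; rewrite /rank rq recurrent_reach //; apply: eq_card => s'.
rewrite !inE; congr (_ && _); apply: eq_existsb => s.
congr [&& _, _ & _]; apply/idP/idP => h; first exact: connect_trans (conn_reach q w) h.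
by apply: connect_trans h; apply/recurrentP.
Qed.

(** In the recurrent case [rank] counts the virtual starts above some [s] with [s w = q0 w]. If [s]
    accepts [w], all of them do; otherwise, by the chain property, those accepting [w] form a proper
    subset, which misses [s]. *)
Lemma rank_correct w : (reach q0 w \in F) =
  (rank (reach q0 w) <= #|[set s in virtual_start | reach s w \in F]|)%N.
Proof.
have cardS : (#|[set s in virtual_start | reach s w \in F]| <= #|virtual_start|)%N.
  by apply/subset_leq_card/fintype.subsetP => s; rewrite inE => /andP[].
rewrite /rank; case: ifP => [rw|_]; last first.
  by case: ifP => //= _; rewrite leqNgt ltnS cardS.
have [s Ss sw] := virtual_start_of rw.
have [rs _] := virtual_startP Ss.
have ws : conn (reach q0 w) s by rewrite -sw; apply/recurrentP.
have -> : #|[set s' in virtual_start |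
    [exists s, [&& s \in virtual_start, conn (reach q0 w) s & lang_le s s']]]| =
  #|[set s' in virtual_start | lang_le s s']|.
  apply: eq_card => s'; rewrite [LHS]inE [RHS]inE; congr (_ && _).
  apply/existsP/idP => [[s1 /and3P[S1 c1]]|le]; last by exists s; rewrite Ss ws.
  apply: lang_le_trans; apply: virtual_start_component => //.
  by apply: connect_trans c1; rewrite -sw; apply: conn_reach.
have [Fw|Fw] := boolP (_ \in F).
  apply/esym/subset_leq_card/fintype.subsetP => s'; rewrite !inE.
  by move=> /andP[-> /asboolP ->] //; rewrite sw.
apply/esym/negbTE; rewrite -ltnNge; apply/proper_card/properP; split.
  apply/fintype.subsetP => s' F'; move: (F'); rewrite inE => /andP[S' {}F'].
  rewrite inE S' /=; have [//|/asboolP le] := orP (virtual_start_chain Ss S').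
  by move: Fw; rewrite -sw le.
exists s; first by rewrite inE Ss; apply/asboolP.
by rewrite inE sw negb_and Fw orbT.
Qed.

(* The transient part of the automaton, made reversible: h remembers for each
   state through which a strongly connected component was entered the state
   before the entrance. *)
Definition unfold_step (hq : {ffun Q -> option Q} * Q) (a : Sigma) :
    option ({ffun Q -> option Q} * Q) :=
  let: (h, q) := hq in let r := dfa_trans q a in
  if recurrent r then None
  else if conn r q then Some (h, r)
  else if h r == None then Some ([ffun s => if s == r then Some q else h s], r)
  else None.

(** If [q2] entered the component from outside, then [a u], with [u] leading from [r] to [q1], would
    fix [q1] and send [q2] to it, making [q1] and [r] recurrent. *)
Lemma unfold_step_mixed q1 q2 a r :
  dfa_trans q1 a = r -> dfa_trans q2 a = r -> conn r q1 -> ~~ recurrent r ->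
  conn r q2.
Proof.
move=> q1a q2a /connP[u ru] nr; apply: contraNT nr => nc.
rewrite -q1a -[dfa_trans q1 a]/(reach q1 [:: a]) recurrent_reach //.
apply: (@fixpoint_recurrent q2 q1 (a :: u)); rewrite /= ?q1a ?q2a //.
by move=> e; move/negP: nc; apply; rewrite e; apply/connP; exists u.
Qed.

(** Two moves inside a component are handled by [component_inj], mixed ones are excluded, and for
    two entrances the record at [r] reveals the source. *)
Lemma unfold_step_inj a hq1 hq2 hr :
  unfold_step hq1 a = Some hr -> unfold_step hq2 a = Some hr -> hq1 = hq2.
Proof.
case: hq1 hq2 hr => [h1 q1] [h2 q2] [h r]; rewrite /unfold_step.
have mixed p q : dfa_trans p a = dfa_trans q a -> ~~ recurrent (dfa_trans q a) ->
    conn (dfa_trans p a) p -> conn (dfa_trans q a) q.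
  move=> e nr; rewrite e => c.
  exact: (unfold_step_mixed e).
case: ifP => // nr1; case: ifP => c1; last case: ifP => // /eqP n1.
- case=> <- <-; case: ifP => // nr2; case: ifP => c2.
    case=> -> e; congr (_, _); apply: (@component_inj _ _ [:: a]) => //=.
    by rewrite -e.
  case: ifP => // _ [_ e]; move: c2.
  by rewrite (mixed q1) ?nr2.
- case=> <- <-; case: ifP => // nr2; case: ifP => c2.
    by case=> _ e; move: c1; rewrite (mixed q2) ?nr1.
  case: ifP => // /eqP n2 [/ffunP hh e]; congr (_, _).
    apply/ffunP => s; have := hh s; rewrite !ffunE e.
    by case: eqP => // -> _; rewrite n1 -e n2.
  by have := hh (dfa_trans q2 a); rewrite !ffunE e eqxx => -[].
Qed.

Definition unfold_inv (hq : {ffun Q -> option Q} * Q) : Prop :=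
  forall s, hq.1 s <> None -> conn s hq.2.

(** An existing record at the new state would make that state reach the current one, so the move
    would not be an entrance. *)
Lemma unfold_stepP hq a : unfold_inv hq -> ~~ recurrent (dfa_trans hq.2 a) ->
  exists2 hr, unfold_step hq a = Some hr & hr.2 = dfa_trans hq.2 a /\ unfold_inv hr.
Proof.
case: hq => h q /= inv nr; rewrite (negbTE nr).
have qr : conn q (dfa_trans q a) := conn_reach q [:: a].
have [c|nc] := boolP (conn _ _).
  by exists (h, dfa_trans q a) => //; split => // s /inv /connect_trans; apply.
have [hn|hn] := eqVneq; last first.
  by case/negP: nc; apply: (inv (dfa_trans q a)); apply/eqP.
eexists; first by []; split => // s /=; rewrite ffunE.
case: eqVneq => [-> _|_ /inv sq]; first exact: connect0.
exact: connect_trans sq qr.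
Qed.

End Recurrence.

(** * Quantum simulation of reversible machines *)

(** The complements of [A] and of its image have equal size and are matched along their
    enumerations. *)
Lemma injective_extension (T : finType) (A : {set T}) (f : T -> T) :
  {in A &, injective f} -> exists g : T -> T, injective g /\ {in A, g =1 f}.
Proof.
move=> injf; pose B := f @: A.
have sz : size (enum (~: A)) = size (enum (~: B)).
  rewrite -!cardE; apply/eqP; rewrite -(eqn_add2l #|A|) cardsC.
  by rewrite -(card_in_imset injf) cardsC.
pose g x := if x \in A then f x else nth x (enum (~: B)) (index x (enum (~: A))).
have idx x : x \notin A -> (index x (enum (~: A)) < size (enum (~: B)))%N.
  by move=> nx; rewrite -sz index_mem mem_enum inE.
have gB x : x \notin A -> g x \notin B.
  move=> nx; rewrite /g (negbTE nx).
  have := mem_nth x (idx x nx); by rewrite mem_enum inE.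
exists g; split=> [x y|x xA]; last by rewrite /g xA.
have [xA|xA] := boolP (x \in A); have [yA|yA] := boolP (y \in A).
- by rewrite /g xA yA; apply: injf.
- by move=> e; have := gB _ yA; rewrite -e /g xA imset_f.
- by move=> e; have := gB _ xA; rewrite e /g yA imset_f.
rewrite /g (negbTE xA) (negbTE yA) (set_nth_default x y) ?idx // => /eqP.
rewrite nth_uniq ?idx ?enum_uniq // => /eqP e.
by rewrite -(nth_index x (_ : x \in enum (~: A))) ?mem_enum ?inE // e
  nth_index // mem_enum inE.
Qed.

(** * Unitary maps and indicator vectors *)

Section Indicators.

Variables (R : realType) (T : finType).
Local Notation C := R[i].

Definition indvec (B : {set T}) : 'cV[C]_#|T| := \col_k (enum_val k \in B)%:R.

Definition injmx (g : T -> T) : 'M[C]_#|T| :=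
  \matrix_(i, j) (enum_val i == g (enum_val j))%:R.

Lemma injmx_indvec g B : injective g -> injmx g *m indvec B = indvec (g @: B).
Proof.
move=> injg; apply/colP => i; rewrite !mxE.
have [/imsetP[t tB ei]|nB] := boolP (_ \in _).
  rewrite (bigD1 (enum_rank t)) //= !mxE enum_rankK ei eqxx tB mulr1 big1 ?addr0 //.
  move=> j jt; rewrite !mxE; case: eqP => [gg|_]; last by rewrite mul0r.
  by move: jt; rewrite ei in gg; rewrite (injg _ _ gg) enum_valK eqxx.
rewrite big1 // => j _; rewrite !mxE; case: eqP => [e|_]; last by rewrite mul0r.
case: (boolP (_ \in B)) => jB; last by rewrite mulr0.
by move: nB; rewrite e imset_f.
Qed.

Lemma injmx_unitary g : injective g -> injmx g \is unitarymx.
Proof.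
move=> injg; apply/unitarymxP/matrixP => i j; rewrite !mxE.
have [t gt] : exists t, g t = enum_val i.
  by exists (invF injg (enum_val i)); rewrite f_invF.
rewrite (bigD1 (enum_rank t)) //= big1 => [|k kt].
  rewrite !mxE enum_rankK gt eqxx mul1r addr0 conjC_nat.
  by rewrite (inj_eq enum_val_inj) eq_sym.
rewrite !mxE; case: eqP => [e|_]; last by rewrite mul0r.
by move: kt; rewrite e in gt; rewrite (injg _ _ gt) enum_valK eqxx.
Qed.

Lemma proj_on_indvec a (H B : {set T}) :
  proj_on H (a *: indvec B) = a *: indvec (B :&: H).
Proof.
by apply/colP => k; rewrite !mxE inE andbC; case: ifP => //= _; rewrite mulr0.
Qed.

Lemma sqnorm_indvec a (B : {set T}) :
  sqnorm (a *: indvec B) = normc a ^+ 2 * #|B|%:R.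
Proof.
rewrite /sqnorm (reindex_onto (@enum_rank T) (@enum_val T T)) => [|i _]; last first.
  exact: enum_valK.
rewrite -sum1_card natr_sum mulr_sumr [RHS]big_mkcond /=.
apply: eq_big => [t|t _]; first by rewrite enum_rankK eqxx.
rewrite !mxE enum_rankK; case: ifP => _; first by rewrite !mulr1.
by rewrite mulr0 normc_sqr /= expr0n addr0.
Qed.

Lemma indvec_dot a (B : {set T}) :
  (a *: indvec B)^T *m (a *: indvec B) = (a * a * #|B|%:R)%:M.
Proof.
apply/matrixP => i j; rewrite !ord1 !mxE mulr1n.
rewrite (reindex_onto (@enum_rank T) (@enum_val T T)) => [|k _]; last first.
  exact: enum_valK.
rewrite -sum1_card natr_sum mulr_sumr [RHS]big_mkcond /=.
apply: eq_big => [t|t _]; first by rewrite enum_rankK eqxx.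
rewrite !mxE enum_rankK; case: ifP => _; first by rewrite !mulr1.
by rewrite !mulr0.
Qed.

(** The Householder reflection along [e - f], a real vector of squared norm 2. *)
Lemma unitary_exchange (e f : 'cV[C]_#|T|) :
  map_mx Num.conj e = e -> map_mx Num.conj f = f -> e^T *m e = 1%:M ->
  f^T *m f = 1%:M -> e^T *m f = 0 ->
  exists2 U : 'M[C]_#|T|, U \is unitarymx & U *m e = f.
Proof.
move=> ce cf ee ff ef; have fe : f^T *m e = 0.
  by rewrite -[f^T *m e]trmxK trmx_mul trmxK ef trmx0.
pose v := e - f; have vT : v^T = e^T - f^T by rewrite linearB.
have vv : v^T *m v = 2%:M.
  rewrite vT mulmxBl !mulmxBr ee ff ef fe subr0 sub0r opprK.
  by rewrite -raddfD.
exists (1%:M - v *m v^T); last first.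
  rewrite mulmxBl mul1mx -mulmxA vT [X in _ *m X]mulmxBl ee fe subr0.
  by rewrite mulmx1 opprB addrC subrK.
have UT : (1%:M - v *m v^T)^T = 1%:M - v *m v^T.
  by rewrite linearB /= trmx1 trmx_mul trmxK.
apply/unitarymxP; rewrite UT map_mxB map_mxM map_mx1.
have cv : map_mx Num.conj v = v by rewrite map_mxB ce cf.
have cvT : map_mx Num.conj v^T = v^T by rewrite -map_trmx cv.
rewrite cv cvT mulmxBl mul1mx mulmxBr mulmx1 -mulmxA (mulmxA v^T) vv.
rewrite mul_scalar_mx -scalemxAr scaler_nat mulr2n.
by rewrite opprB addrK subrK.
Qed.

End Indicators.

Section Machine.

Variables (R : realType) (Sigma X : finType).
Local Notation C := R[i].
Variable step : tape_symbol Sigma -> X -> X + bool.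
Hypothesis step_inj : forall a x x' y,
  step a x = inl y -> step a x' = inl y -> x = x'.

Fixpoint machine_run x u : option bool :=
  if u is a :: u' then
    match step a x with inl y => machine_run y u' | inr b => Some b end
  else None.

Local Notation Q := (X + X * bool)%type.

Definition halted (b : bool) : {set Q} :=
  [set q | if q is inr (_, b') then b' == b else false].

(** A halted state keeps [x] beside the verdict, so that halting moves are injective too. *)
Definition transition (a : tape_symbol Sigma) (q : Q) : Q :=
  if q is inl x then match step a x with inl y => inl y | inr b => inr (x, b) end
  else q.

Lemma transition_inj a : {in [set q : Q | if q is inl _ then true else false] &,
  injective (transition a)}.
Proof.
move=> [x|p] [x'|p']; rewrite !inE //= => _ _.
case sx: (step a x) => [y|b]; case sx': (step a x') => [y'|b'] //.
  by case=> e; rewrite -e in sx'; rewrite (step_inj sx sx').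
by case=> ->.
Qed.

(** The left endmarker creates the uniform superposition over [I]; injective moves preserve the
    common amplitude, so halting probabilities count configurations. *)
Lemma machine_qfa (I : {set X}) : (0 < #|I|)%N ->
  exists A : qfa R Sigma, forall w,
    accept_prob A w =
      #|[set x in I | machine_run x (rest w) == Some true]|%:R / #|I|%:R /\
    reject_prob A w =
      #|[set x in I | machine_run x (rest w) == Some false]|%:R / #|I|%:R.
Proof.
move=> I0; have [x0 x0I] := card_gt0P I0.
have /choice[g g_ext] a := injective_extension (@transition_inj a).
pose n : R := #|I|%:R; have n0 : 0 < n by rewrite ltr0n.
pose a : C := ((Num.sqrt n)^-1)%:C.
have a2 : normc a ^+ 2 = n^-1.
  by rewrite normc_sqr /= expr0n addr0 exprVn sqr_sqrtr // ltW.
pose inlI (B : {set X}) : {set Q} := [set inl x | x in B].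
(* A state outside [inlI I], hence orthogonal to [psi]; [U] acts before the first measurement. *)
pose start : Q := inr (x0, true).
pose psi := a *: indvec R (inlI I).
have [U U_unit U_start] : exists2 U : 'M[C]_#|{: Q}|, U \is unitarymx &
    U *m ket R start = psi.
  have aa : a * a * #|inlI I|%:R = 1.
    have -> : #|inlI I|%:R = n%:C by rewrite /n rmorph_nat card_imset // => x y [].
    rewrite -!rmorphM /= -expr2 exprVn sqr_sqrtr ?ltW //.
    by rewrite mulVf ?rmorph1 // gt_eqF.
  apply: unitary_exchange.
  - by apply/matrixP => i j; rewrite !mxE conjC_nat.
  - apply/matrixP => i j; rewrite /psi !mxE.
    by case: (_ \in _); rewrite ?mulr1 ?mulr0; apply/eqP; rewrite eq_complex /= oppr0 !eqxx.
  - apply/matrixP => i j; rewrite !ord1 !mxE (bigD1 (enum_rank start)) //= big1.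
      by rewrite !mxE !eqxx mulr1 addr0.
    by move=> k kn; rewrite !mxE (negbTE kn) mul0r.
  - by rewrite indvec_dot aa.
  apply/matrixP => i j; rewrite !ord1 !mxE big1 // => k _; rewrite !mxE.
  have [->|kn] := eqVneq k (enum_rank start); last by rewrite mul0r.
  rewrite enum_rankK; case: imsetP => [[] //|_]; by rewrite !mulr0.
pose trans (s : tape_symbol Sigma) : 'M[C]_#|{: Q}| :=
  if s is LeftEnd then U else injmx R (g s).
have trans_unit s : trans s \is unitarymx.
  by case: s => [|c|] //=; apply: injmx_unitary; apply: (g_ext _).1.
have disj : [disjoint halted true & halted false].
  by apply/pred0P => -[x|[x b]] /=; rewrite !inE //; case: b.
pose A := @Qfa R Sigma Q trans start (halted true) (halted false) trans_unit disj.
have nonE : qfa_non A = [set q : Q | if q is inl _ then true else false].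
  by apply/setP => -[x|[x b]]; rewrite !inE //; case: b.
have halt (b : bool) (B : {set X}) u :
    all (fun s => if s is LeftEnd then false else true) u ->
    @halting_prob R Sigma A (halted b) (a *: indvec R (inlI B)) u =
    n^-1 * #|[set x in B | machine_run x u == Some b]|%:R.
  elim: u B => [|s u IH] B /=.
    move=> _; rewrite (_ : [set _ in _ | _] = finset.set0) ?cards0 ?mulr0 //.
    by apply/setP => x; rewrite !inE andbF.
  move=> /andP[sn un].
  have -> : trans s = injmx R (g s) by case: s sn.
  rewrite -scalemxAr injmx_indvec; last exact: (g_ext s).1.
  rewrite !proj_on_indvec sqnorm_indvec a2.
  set G := g s @: _.
  have GE q : (q \in G) = [exists x in B, q == transition s (inl x)].
    apply/imsetP/exists_inP => [[_ /imsetP[x xB ->] ->]|[x xB /eqP ->]].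
      by exists x => //; rewrite (g_ext s).2 ?inE.
    by exists (inl x); [apply: imset_f | rewrite (g_ext s).2 ?inE].
  pose B' := [set y | [exists x in B, step s x == inl y]].
  have -> : G :&: qfa_non A = inlI B'.
    apply/setP => q; rewrite nonE finset.in_setI GE [in X in _ && X]inE.
    apply/andP/imsetP => [[/exists_inP[x xB /eqP]]|[y]].
      rewrite /transition; case sx: (step s x) => [y|b'] -> // _.
      by exists y => //; rewrite inE; apply/exists_inP; exists x => //; apply/eqP.
    rewrite inE => /exists_inP[x xB /eqP sx] ->; split=> //.
    by apply/exists_inP; exists x => //=; rewrite sx.
  rewrite IH // -mulrDr -natrD; congr (_ * _%:R).
  have -> : G :&: halted b = (fun x => inr (x, b)) @: [set x in B | step s x == inr b].
    apply/setP => q; rewrite finset.in_setI GE [in X in _ && X]inE.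
    apply/andP/imsetP => [[/exists_inP[x xB /eqP]]|[x]].
      rewrite /transition; case sx: (step s x) => [y|b'] -> // /eqP <-.
      by exists x => //; rewrite inE xB sx eqxx.
    rewrite inE => /andP[xB /eqP sx] ->; split=> //.
    by apply/exists_inP; exists x => //=; rewrite sx.
  rewrite card_imset; last by move=> x y [].
  (* Survivors are counted by their origins, which together with the configurations halting now
     partition the wanted subset of [B]. *)
  pose D := [set x in B | if step s x is inl y then machine_run y u == Some b else false].
  have -> : [set y in B' | machine_run y u == Some b] =
      (fun x => if step s x is inl y then y else x) @: D.
    apply/setP => y; rewrite inE; apply/andP/imsetP.
      rewrite inE => -[/exists_inP[x xB /eqP sx] yb]; exists x; last by rewrite sx.
      by rewrite inE xB sx.
    move=> [x]; rewrite inE => /andP[xB]; case sx: (step s x) => [z|//] zb ->.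
    by split=> //; rewrite inE; apply/exists_inP; exists x => //; apply/eqP.
  rewrite card_in_imset; last first.
    move=> x x'; rewrite !inE => /andP[_ +] /andP[_ +].
    case sx: (step s x) => [z|//]; case sx': (step s x') => [z'|//] _ _ e.
    by rewrite -e in sx'; apply: step_inj sx sx'.
  have disjD : [set x in B | step s x == inr b] :&: D = finset.set0.
    by apply/setP => x; rewrite !inE; case: (step s x) => [y|b']; rewrite ?andbF.
  have := cardsUI [set x in B | step s x == inr b] D.
  rewrite disjD cards0 addn0 => <-; apply: eq_card => x; rewrite !inE -andb_orr.
  by congr (_ && _); case: (step s x) => [y|b'] /=; rewrite ?orbF.
have all_rest w : all (fun s => if s is LeftEnd then false else true) (@rest Sigma w).
  by rewrite /rest all_rcons /= /letters all_map; apply/allP.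
have nohalt b : inlI I :&: halted b = finset.set0.
  by apply/setP => q; rewrite !inE; apply/negbTE/negP => /andP[/imsetP[x _ ->]].
have noninlI : inlI I :&: qfa_non A = inlI I.
  by apply/finset.setIidPl/fintype.subsetP => _ /imsetP[x _ ->]; rewrite nonE inE.
exists A => w; rewrite /accept_prob /reject_prob /= -/(rest w) U_start.
rewrite !proj_on_indvec !sqnorm_indvec !nohalt cards0 mulr0 !add0r noninlI.
by rewrite !halt ?all_rest // ![n^-1 * _]mulrC.
Qed.

End Machine.

(** * The majority vote *)

Lemma card_ord_geq n d : #|[set j : 'I_n | d <= j]%N| = (n - d)%N.
Proof.
rewrite -sum1_card -[RHS]muln1 -sum_nat_const_nat big_geq_mkord /=.
by apply: eq_bigl => j; rewrite inE.
Qed.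

Section Sufficiency.

Variables (R : realType) (Sigma : finType) (L : set (seq Sigma)) (M : dfa Sigma).
Local Notation Q := (dfa_state M).
Local Notation F := (dfa_final M).
Local Notation q0 := (dfa_start M).
Hypothesis noI : ~ construction_I M.
Hypothesis noII : ~ construction_II M.
Hypothesis no2 : ~ two_cycles_in_a_row M.

Local Notation k := #|virtual_start M|.
Local Notation U := ({ffun Q -> option Q} * Q)%type.
Local Notation X := (Q + 'I_k.+1 * U)%type.

(** The test [recurrent s] makes the moves of the virtual runs injective. The value at [LeftEnd] is
    a default, as a run starts after that marker. *)
Definition vote_step (a : tape_symbol Sigma) (x : X) : X + bool :=
  match a, x with
  | LeftEnd, _ => inr false
  | Letter c, inl s => if recurrent s then inl (inl (dfa_trans s c)) else inr false
  | Letter c, inr (j, hq) =>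
      if unfold_step hq c is Some hr then inl (inr (j, hr))
      else inr (rank (dfa_trans hq.2 c) <= j)%N
  | RightEnd, inl s => inr (s \in F)
  | RightEnd, inr (j, hq) => inr (rank hq.2 <= j)%N
  end.

Lemma vote_step_inj a x x' y :
  vote_step a x = inl y -> vote_step a x' = inl y -> x = x'.
Proof.
case: a x x' => [|c|] //; last by move=> [s|[j hq]].
move=> [s|[j hq]] [s'|[j' hq']] /=.
- case: ifP => // rs [<-]; case: ifP => // rs' [e].
  by rewrite (@recurrent_inj _ _ noI s s' [:: c]).
- by case: ifP => // rs [<-]; case: unfold_step.
- by case: (unfold_step hq c) => // ? [<-]; case: ifP.
case E: (unfold_step hq c) => [hr|//] [<-].
case E': (unfold_step hq' c) => [hr'|//] [-> e].
by rewrite e in E'; rewrite (unfold_step_inj noI no2 E E').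
Qed.

Lemma run_virtual s w : recurrent s ->
  machine_run vote_step (inl s) (rest w) = Some (reach s w \in F).
Proof.
elim: w s => [//|a w IH] s rs; rewrite /= rs.
by apply: IH; apply: (recurrent_reach [:: a] rs).
Qed.

(** The answer given on entering a recurrent state remains valid for the rest of the word by
    [rank_reach]. *)
Lemma run_unfold j hq w : unfold_inv hq ->
  machine_run vote_step (inr (j, hq)) (rest w) = Some (rank (reach hq.2 w) <= j)%N.
Proof.
elim: w hq => [//|a w IH] hq inv.
have [r|nr] := boolP (recurrent (dfa_trans hq.2 a)).
  rewrite [LHS]/= [unfold_step _ _](_ : _ = None); last first.
    by move: r; case: hq {inv} => h q /= ->.
  by rewrite [reach _ _]/= rank_reach.
have [hr e [hr2 inv']] := unfold_stepP inv nr.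
by rewrite [LHS]/= e [reach _ _]/= -hr2; apply: IH.
Qed.

Lemma recognizable_of_no_constructions : dfa_recognizes M L -> qfa_recognizable R L.
Proof.
move=> MrecL; pose init : X -> bool := fun x =>
  match x with
  | inl s => s \in virtual_start M
  | inr (_, hq) => hq == ([ffun=> None], q0)
  end.
pose hq0 : U := ([ffun=> None], q0).
have count (P : X -> bool) : #|[set x | init x && P x]| =
    (#|[set s in virtual_start M | P (inl s)]| +
     #|[set j : 'I_k.+1 | P (inr (j, hq0))]|)%N.
  pose S1 := [set s in virtual_start M | P (inl s)].
  pose S2 := [set j : 'I_k.+1 | P (inr (j, hq0))].
  have -> : [set x | init x && P x] =
      (inl @: S1) :|: ((fun j => inr (j, hq0) : X) @: S2).
    apply/setP => x; rewrite [LHS]inE finset.in_setU; case: x => [s|[j hq]] /=.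
      rewrite mem_imset ?inE; last by move=> ? ? [].
      by case: (imsetP) => [[]//|_]; rewrite orbF.
    case: imsetP => [[]//|_] /=; apply/andP/imsetP => [[/eqP -> Pj]|[j']].
      by exists j; rewrite ?inE.
    by rewrite inE => Pi [-> ->].
  rewrite cardsU [X in (_ - X)%N](_ : _ = 0%N) ?subn0; last first.
    apply/eqP; rewrite finset.cards_eq0; apply/eqP/setP => x; rewrite !inE.
    by apply/negbTE/negP => /andP[/imsetP[s _ ->]]; case/imsetP.
  by rewrite (@card_imset _ _ inl) 1?card_imset // => x y [].
pose I : {set X} := [set x | init x].
have cardI : #|I| = (k + k.+1)%N.
  have := count predT; rewrite (_ : [set x | _] = I); last first.
    by apply/setP => x; rewrite !inE andbT.
  move=> ->; congr (_ + _)%N.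
    by apply: eq_card => s; rewrite [LHS]inE andbT.
  by rewrite -[RHS](card_ord k.+1); apply: eq_card => j; rewrite !inE.
have I0 : (0 < #|I|)%N by rewrite cardI addnS.
have [A HA] := @machine_qfa R Sigma X vote_step vote_step_inj I I0.
pose votes (b : bool) w := #|[set x in I | machine_run vote_step x (rest w) == Some b]|.
have inv0 : unfold_inv hq0 by move=> s; rewrite ffunE.
have votes_true w : votes true w =
    (#|[set s in virtual_start M | reach s w \in F]| +
     (k.+1 - rank (reach q0 w)))%N.
  rewrite /votes (_ : [set x in I | _] =
    [set x | init x && (machine_run vote_step x (rest w) == Some true)]); last first.
    by apply/setP => x; rewrite !inE.
  rewrite count; congr (_ + _)%N.
    apply: eq_card => s; rewrite [LHS]inE [RHS]inE.
    case: (boolP (s \in _)) => //= /virtual_startP[rs _].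
    by rewrite run_virtual //; case: (_ \in F).
  rewrite -card_ord_geq; apply: eq_card => j; rewrite [LHS]inE [RHS]inE.
  by rewrite run_unfold //; case: (_ <= _)%N.
have votes_total w : (votes true w + votes false w)%N = (k + k.+1)%N.
  rewrite -cardI /votes -cardsUI [X in (_ + X)%N](_ : _ = 0%N) ?addn0; last first.
    apply/eqP; rewrite cards_eq0; apply/eqP/setP => x; rewrite !inE.
    by case: machine_run => [[]|]; rewrite ?andbF.
  apply: eq_card => x; rewrite !inE -andb_orr; case: x => [s|[j hq]] /=.
    case: (boolP (s \in virtual_start M)) => //= /virtual_startP[rs _].
    by rewrite run_virtual //; case: (_ \in F).
  by case: eqP => // ->; rewrite run_unfold //; case: (_ <= _)%N.
(* A majority is [k + 1] of [2k + 1] votes. The thresholds contribute [k + 1 - rank], so acceptance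
   wins exactly when [rank] is at most the number of accepting virtual starts. *)
exists A, (k.+1%:R / #|I|%:R); split.
  rewrite cardI ltr_pdivlMr ?ltr0n ?addnS // mulrC ltr_pdivrMr // -natrM ltr_nat.
  by rewrite muln2 -addnn -addnS ltnS leq_add2r.
move=> w; have [-> ->] := HA w; have correct := rank_correct noI noII w.
have rk := rank_le (reach q0 w).
have tot := votes_total w; have vt := votes_true w.
split=> Lw; rewrite ler_pM2r ?invr_gt0 ?ltr0n // ler_nat -/(votes _ w).
  by move/MrecL: Lw; rewrite correct; lia.
have: reach q0 w \notin F by apply/negP => /MrecL.
by rewrite correct; lia.
Qed.

End Sufficiency.

Theorem theorem2p2 (R : realType) (Sigma : finType) (L : set (seq Sigma))
    (M : dfa Sigma) (M_min : minimal_dfa M L)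
    (M_no_two_cycles : ~ two_cycles_in_a_row M) :
  qfa_recognizable R L <-> ~ construction_I M /\ ~ construction_II M.
Proof.
split=> [[A [p [p_gt A_rec]]]|[noI noII]].
  split; first exact: (recognizable_no_construction_I M_min p_gt A_rec).
  exact: (recognizable_no_construction_II M_min p_gt A_rec).
exact: (recognizable_of_no_constructions R noI noII M_no_two_cycles M_min.1).
Qed.
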